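(* Let $N,M\in\mathbb{N}$ and $\mathcal{S}_{N,M}=\{x\in\mathbb{Z}^N:\|x\|_1\le M\}$. Suppose $W\ge2$, $L\ge1$ are integers such that for every $(x_1,\dots,x_N)^\top\in\mathcal{S}_{N,M}$ there exists $g\in\mathcal{NN}_{1,1}(W,L)$ with $g(n)=x_n$ for $n=1,\dots,N$. (1) If $N\ge M\ge C_0N^{1/p}$ for some $p\ge1$ and constant $C_0>0$, then $W^2L^2\log(WL)\ge C_p\,M(1+\log(N/M))$ for a constant $C_p>0$ depending only on $p$ and $C_0$. (2) If $N\le M\le C_0N^{p}$ for some $p\ge1$ and constant $C_0>0$, then $W^2L^2\log(WL)\ge C_p\,N(1+\log(M/N))$ for a constant $C_p>0$ depending only on $p$ and $C_0$.
   Context: $\mathcal{NN}_{d,k}(W,L)$: set of maps $g:\mathbb{R}^d\to\mathbb{R}^k$ given by $g_0(x)=x$, $g_{\ell+1}(x)=\sigma(A_\ell g_\ell(x)+b_\ell)$ ($\ell=0,\dots,L-1$), $g(x)=A_Lg_L(x)+b_L$, with $A_\ell\in\mathbb{R}^{N_{\ell+1}\times N_\ell}$, $b_\ell\in\mathbb{R}^{N_{\ell+1}}$, $N_0=d$, $N_{L+1}=k$, $\max\{N_1,\dots,N_L\}\le W$, $\sigma(t)=\max\{t,0\}$ componentwise. *)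

(* Defs.v *)
From Stdlib Require Import Reals ZArith.
Open Scope R_scope.

Fixpoint rsum (n : nat) (f : nat -> R) : R :=
  match n with
  | O => 0
  | S m => rsum m f + f m
  end.

Definition relu (t : R) : R := Rmax t 0.

(* Parameters of a fully connected ReLU network.
   widths l = N_l ; A l i j = entry (i,j) of A_l in R^{N_(l+1) x N_l}
   (only i < N_(l+1), j < N_l are relevant); b l i = i-th entry of b_l.
   Vectors of R^n are represented as functions nat -> R, of which only
   the indices < n are relevant. *)
Record nn_params := NNParams {
  widths : nat -> nat;
  weight : nat -> nat -> nat -> R;
  bias : nat -> nat -> R
}.

Fixpoint nn_layer (P : nn_params) (x : nat -> R) (l : nat) : nat -> R :=
  match l with
  | O => x
  | S l' => fun i =>
      relu (rsum (widths P l') (fun j => weight P l' i j * nn_layer P x l' j)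
            + bias P l' i)
  end.

Definition nn_output (P : nn_params) (L : nat) (x : nat -> R) : nat -> R :=
  fun i => rsum (widths P L) (fun j => weight P L i j * nn_layer P x L j)
           + bias P L i.

Definition nn_arch (P : nn_params) (d k W L : nat) : Prop :=
  widths P 0 = d /\ widths P (S L) = k /\
  (forall l, (1 <= l <= L)%nat -> (widths P l <= W)%nat).

Definition NN11 (W L : nat) (g : R -> R) : Prop :=
  exists P : nn_params, nn_arch P 1 1 W L /\
    forall t : R, g t = nn_output P L (fun _ => t) 0%nat.

Definition interpolates_SNM (N M W L : nat) : Prop :=
  forall x : nat -> Z,
    rsum N (fun n => IZR (Z.abs (x (S n)))) <= INR M ->
    exists g : R -> R, NN11 W L g /\
      forall n : nat, (1 <= n <= N)%nat -> g (INR n) = IZR (x n).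

(* Main.v *)
Require Import Defs.
From Stdlib Require Import Reals ZArith Psatz.
From mathcomp Require all_boot all_order all_algebra.
From mathcomp Require all_classical all_reals all_analysis Rstruct zify ring lra.
Open Scope R_scope.

(* A sign-pattern count in the manner of Warren and of Bartlett, Harvey, Liaw and
   Mehrabian.

   Polynomials f_1, ..., f_m of degree d in n variables have at most (2md+1)^n sign
   patterns at points where none of them vanishes: with F = (f_1 ... f_m)^2 and D =
   2md, the function F - e (x_1^(D+2) + ... + x_n^(D+2)) has, for small e > 0, a
   positive maximum in every sign cell that occurs, hence a critical point there. The
   critical points satisfy x_i^(D+1) = g_i(x) with deg g_i <= D, so on them every
   polynomial is a combination of the (D+1)^n monomials with all exponents at most D,
   whereas polynomials separate points; hence there are at most (D+1)^n of them.

   Within a set of networks sharing the activation pattern of the first l layers, the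
   preactivations of the next layer are fixed polynomials in the weights, so keeping
   only the most frequent pattern, layer by layer, loses a factor (C W L
   #inputs)^(O(W^2 L)) per layer. Let A = min(N, M), T = max(N, M), Q = floor(T / A).
   Some (Q+1)^A vectors of S_{N,M} are told apart by A Q threshold conditions, so A
   log(Q+1) <= C W^2 L^2 log(T W L). As T is polynomially bounded in A, this forces
   log T = O(log(WL)), which gives both claims. *)

(** * Polynomial functions *)

Module PolynomialFunctions.

Import all_boot all_order all_algebra boolp zify ring.
Set Implicit Arguments.
Unset Strict Implicit.
Unset Printing Implicit Defensive.
Import Order.TTheory GRing.Theory Num.Theory.
Local Open Scope ring_scope.

(** The index is only an upper bound for the degree. Working with functions instead of formal
    polynomials turns later degree estimates into closure arguments. *)
Inductive polyfun (R : fieldType) (n : nat) : nat -> ('rV[R]_n -> R) -> Prop :=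
| polyfun_cst d c : polyfun d (fun=> c)
| polyfun_var d i : polyfun d.+1 (fun x => x 0 i)
| polyfunD d f g : polyfun d f -> polyfun d g -> polyfun d (fun x => f x + g x)
| polyfunM d e f g : polyfun d f -> polyfun e g -> polyfun (d + e) (fun x => f x * g x).

Section PolyFun.
Variables (R : fieldType) (n : nat).
Implicit Types (f g : 'rV[R]_n -> R) (x : 'rV[R]_n) (a b : {ffun 'I_n -> nat}).

Lemma polyfun_leq d e f : (d <= e)%N -> polyfun d f -> polyfun e f.
Proof.
move=> + pf; elim: pf e => {d f} [d c|d i|d f g _ IHf _ IHg|d k f g pf _ pg IHg] e le_de.
- exact: polyfun_cst.
- by case: e le_de => // e _; apply: polyfun_var.
- by apply: polyfunD; [apply: IHf|apply: IHg].
- have -> : e = (d + (e - d))%N by lia.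
  by apply: polyfunM => //; apply: IHg; lia.
Qed.

Lemma polyfun_exp d f k : polyfun d f -> polyfun (k * d) (fun x => f x ^+ k).
Proof.
move=> pf; elim: k => [|k IH]; first exact: polyfun_cst.
have -> : (fun x => f x ^+ k.+1) = (fun x => f x * f x ^+ k).
  by apply: funext => x; rewrite exprS.
exact: polyfunM.
Qed.

Lemma polyfun_sum (I : Type) (s : seq I) d (F : I -> 'rV[R]_n -> R) :
  (forall i, polyfun d (F i)) -> polyfun d (fun x => \sum_(i <- s) F i x).
Proof.
move=> pF; elim: s => [|i s IH].
  rewrite (_ : (fun _ => _) = fun=> 0); first exact: polyfun_cst.
  by apply: funext => x; rewrite big_nil.
rewrite (_ : (fun _ => _) = fun x => F i x + \sum_(j <- s) F j x).
  exact: polyfunD.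
by apply: funext => x; rewrite big_cons.
Qed.

Lemma polyfun_prod (I : Type) (s : seq I) d (F : I -> 'rV[R]_n -> R) :
  (forall i, polyfun d (F i)) -> polyfun (size s * d) (fun x => \prod_(i <- s) F i x).
Proof.
move=> pF; elim: s => [|i s IH].
  rewrite (_ : (fun _ => _) = fun=> 1); first exact: polyfun_cst.
  by apply: funext => x; rewrite big_nil.
rewrite (_ : (fun _ => _) = fun x => F i x * \prod_(j <- s) F j x).
  exact: polyfunM.
by apply: funext => x; rewrite big_cons.
Qed.

Definition monom a x : R := \prod_i x 0 i ^+ a i.

Lemma monomM a b x : monom a x * monom b x = monom [ffun i => a i + b i]%N x.
Proof.
by rewrite -big_split /=; apply: eq_bigr => i _; rewrite ffunE exprD.
Qed.

Lemma polyfun_monom a : polyfun (\sum_i a i) (monom a).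
Proof.
rewrite /monom; elim: (index_enum _) => [|i s IH].
  rewrite (_ : (fun _ => _) = fun=> 1); first exact: polyfun_cst.
  by apply: funext => x; rewrite big_nil.
rewrite big_cons (_ : (fun _ => _) = fun x => x 0 i ^+ a i * \prod_(j <- s) x 0 j ^+ a j).
  apply: polyfunM => //; rewrite -[a i]muln1.
  by have := @polyfun_exp 1 (fun x => x 0 i) (a i) (@polyfun_var _ _ 0 i); rewrite muln1.
by apply: funext => x; rewrite big_cons.
Qed.

Lemma polyfun_expand d f : polyfun d f ->
  exists2 s : seq (R * {ffun 'I_n -> nat}),
    forall p, p \in s -> (\sum_i p.2 i <= d)%N &
    forall x, f x = \sum_(p <- s) p.1 * monom p.2 x.
Proof.
elim=> {d f} [d c|d i|d f g _ [s hs fE] _ [t ht gE]|d e f g _ [s hs fE] _ [t ht gE]].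
- exists [:: (c, [ffun=> 0%N])] => [p|x].
    by rewrite inE => /eqP->; rewrite big1 // => i _; rewrite ffunE.
  by rewrite big_seq1 /monom big1 ?mulr1 // => i _; rewrite ffunE.
- exists [:: (1, [ffun j => (j == i) : nat])] => [p|x].
    rewrite inE => /eqP->; rewrite (bigD1 i) //= ffunE eqxx big1 // => j ji.
    by rewrite ffunE (negbTE ji).
  rewrite big_seq1 /monom mul1r (bigD1 i) //= ffunE eqxx big1 ?mulr1 // => j ji.
  by rewrite ffunE (negbTE ji).
- exists (s ++ t) => [p|x]; last by rewrite big_cat fE gE.
  by rewrite mem_cat => /orP[/hs|/ht].
- pose mulm (p q : R * {ffun 'I_n -> nat}) : R * {ffun 'I_n -> nat} :=
    (p.1 * q.1, [ffun i => p.2 i + q.2 i]%N).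
  exists [seq mulm p q | p <- s, q <- t] => [p|x].
    move=> /allpairsP[[u v] /= [/hs hu /ht hv ->]] /=.
    under eq_bigr do rewrite ffunE.
    by rewrite big_split leq_add.
  rewrite big_allpairs_dep fE gE big_distrlr /=.
  apply: eq_bigr => p _; apply: eq_bigr => q _.
  by rewrite -monomM; ring.
Qed.

(* A functional supported on the common zeros can be evaluated after replacing
   [x_i ^ D.+1] by [g i], which lowers the degree. *)
Lemma reduced_monoms_determine (D K : nat) (g : 'I_n -> 'rV[R]_n -> R)
    (z : 'I_K -> 'rV[R]_n) (v : 'I_K -> R) :
  (forall i, polyfun D (g i)) ->
  (forall k i, z k 0 i ^+ D.+1 = g i (z k)) ->
  (forall a : {ffun 'I_n -> 'I_D.+1},
     \sum_k v k * monom [ffun i => a i : nat] (z k) = 0) ->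
  forall d f, polyfun d f -> \sum_k v k * f (z k) = 0.
Proof.
move=> pg zg v0 d; elim/ltn_ind: d => d IH f /polyfun_expand[s hs fE].
under eq_bigr do rewrite fE mulr_sumr.
rewrite exchange_big big_seq big1 // => -[c a] /hs /= ha.
under eq_bigr do rewrite mulrCA.
rewrite -mulr_sumr; apply/eqP; rewrite mulf_eq0; apply/orP; right; apply/eqP.
have [/existsP[i leDa]|] := boolP [exists i, (D < a i)%N]; last first.
  rewrite negb_exists => /forallP a_small.
  rewrite -[RHS](v0 [ffun i => inord (a i)]); apply: eq_bigr => k _.
  congr (_ * monom _ _); apply/ffunP => i; rewrite !ffunE inordK //.
  by rewrite ltnS leqNgt a_small.
pose b := [ffun j => if j == i then (a i - D.+1)%N else a j].
have aE : (\sum_j a j = \sum_j b j + D.+1)%N.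
  rewrite (bigD1 i) //= [in RHS](bigD1 i) //= ffunE eqxx addnAC subnK //.
  by congr addn; apply: eq_bigr => j ji; rewrite ffunE (negbTE ji).
have -> : \sum_k v k * monom a (z k) = \sum_k v k * (g i (z k) * monom b (z k)).
  apply: eq_bigr => k _; congr (_ * _); rewrite -zg /monom.
  rewrite (bigD1 i) //= [in RHS](bigD1 i) //= ffunE eqxx mulrA -exprD subnKC //.
  by congr (_ * _); apply: eq_bigr => j ji; rewrite ffunE (negbTE ji).
apply: (IH (D + \sum_j b j)%N _ (fun x => g i x * monom b x)).
  by rewrite aE addnS addnC in ha.
by apply: polyfunM => //; apply: polyfun_monom.
Qed.

(** For each [l != k] some coordinate distinguishes [z k] from [z l]; the product of the factors
    [x 0 i - z l 0 i] separates. *)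
Lemma polyfun_separate (K : nat) (z : 'I_K -> 'rV[R]_n) (k : 'I_K) :
  injective z -> exists d f, [/\ polyfun d f, f (z k) != 0 &
    forall l, l != k -> f (z l) = 0].
Proof.
move=> z_inj.
have /fin_all_exists[h hP] : forall l, exists h,
    [/\ polyfun 1 h, h (z k) != 0 & l != k -> h (z l) = 0].
  move=> l; have [->|lk] := eqVneq l k.
    by exists (fun=> 1); split=> //; [exact: polyfun_cst|exact: oner_neq0].
  have /existsP[i zi] : [exists i, z k 0 i != z l 0 i].
    apply: contraNT lk; rewrite negb_exists => /forallP zE.
    by apply/eqP/z_inj/rowP => i; apply/esym/eqP; move: (zE i); rewrite negbK.
  exists (fun x => x 0 i + (- z l 0 i)); split; rewrite ?subr_eq0 ?subrr //.
  by apply: polyfunD; [apply: polyfun_var|apply: polyfun_cst].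
exists (size (index_enum 'I_K) * 1)%N, (fun x => \prod_l h l x); split.
- by apply: polyfun_prod => l; have [] := hP l.
- by rewrite prodf_seq_neq0; apply/allP => l _; have [] := hP l.
- by move=> l lk; have [_ _ /(_ lk) h0] := hP l; rewrite (bigD1 l) //= h0 mul0r.
Qed.

(** A left kernel vector of the evaluation matrix [E] on the reduced monomials annihilates every
    polynomial, so separation makes it zero. The rows are thus independent, and [K] is at most the
    number of columns. *)
Lemma card_common_zeros (D K : nat) (g : 'I_n -> 'rV[R]_n -> R)
    (z : 'I_K -> 'rV[R]_n) :
  injective z -> (forall i, polyfun D (g i)) ->
  (forall k i, z k 0 i ^+ D.+1 = g i (z k)) -> (K <= D.+1 ^ n)%N.
Proof.
move=> z_inj pg zg.
pose T := {ffun 'I_n -> 'I_D.+1}.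
pose E := \matrix_(k < K, t < #|T|)
  monom [ffun i => (enum_val t : T) i : nat] (z k).
suff /eqP <- : row_free E.
  by apply: leq_trans (rank_leq_col _) _; rewrite card_ffun !card_ord.
rewrite -kermx_eq0; apply/rowV0P => v /sub_kermxP vE.
have v0 d f : polyfun d f -> \sum_k v 0 k * f (z k) = 0.
  apply: (reduced_monoms_determine pg zg) => a.
  have := congr1 (fun A : 'rV_#|T| => A 0 (enum_rank a)) vE.
  rewrite !mxE => vE0; rewrite -[RHS]vE0; apply: eq_bigr => k _.
  by rewrite !mxE enum_rankK.
apply/rowP => k; rewrite mxE.
have [d [f [pf fk fl]]] := polyfun_separate k z_inj.
have := v0 d f pf; rewrite (bigD1 k) //= big1 ?addr0 => [|l /fl ->]; last by rewrite mulr0.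
by move/eqP; rewrite mulf_eq0 (negbTE fk) orbF => /eqP.
Qed.

(** [g] is the partial derivative, seen through the restriction of [f] to an axis line. Keeping the
    bound [d] instead of [d - 1] frees the Leibniz rule of subtraction. *)
Lemma polyfun_partial d f (i : 'I_n) : polyfun d f ->
  exists2 g, polyfun d g & forall x, exists2 p : {poly R},
    forall t, f (x + t *: delta_mx 0 i) = p.[t] & p^`().[0] = g x.
Proof.
elim=> {d f} [d c|d j|d f g _ [f' pf' hf] _ [g' pg' hg]
             |d e f g pf [f' pf' hf] pg [g' pg' hg]].
- exists (fun=> 0) => [|x]; first exact: polyfun_cst.
  by exists c%:P => [t|]; rewrite ?hornerC // derivC horner0.
- exists (fun=> (i == j)%:R) => [|x]; first exact: polyfun_cst.
  exists ((x 0 j)%:P + (i == j)%:R *: 'X) => [t|].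
    by rewrite !mxE eqxx eq_sym !hornerE mulrC.
  by rewrite derivD derivC derivZ derivX !hornerE.
- exists (fun x => f' x + g' x) => [|x]; first exact: polyfunD.
  have [[p pE p'E] [q qE q'E]] := (hf x, hg x).
  by exists (p + q) => [t|]; rewrite ?derivD hornerE ?pE ?qE ?p'E ?q'E.
- exists (fun x => f' x * g x + f x * g' x) => [|x].
    by apply: polyfunD; apply: polyfunM.
  have [[p pE p'E] [q qE q'E]] := (hf x, hg x).
  exists (p * q) => [t|]; first by rewrite hornerM pE qE.
  rewrite derivM !hornerE p'E q'E; have := (pE 0, qE 0).
  by rewrite scale0r addr0 => -[<- <-].
Qed.
End PolyFun.

Lemma polyfun_bound (R : realFieldType) n d (f : 'rV[R]_n -> R) : polyfun d f ->
  exists C, forall (x : 'rV[R]_n) (r : R), 1 <= r ->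
    (forall i, `|x 0 i| <= r) -> `|f x| <= C * r ^+ d.
Proof.
elim=> {d f} [d c|d j|d f g _ [B hB] _ [C hC]|d e f g _ [B hB] _ [C hC]].
- by exists `|c| => x r r1 _; rewrite ler_peMr // exprn_ege1.
- exists 1 => x r r1 /(_ j) xr; rewrite mul1r (le_trans xr) // ler_eXnr //.
- exists (B + C) => x r r1 xr; rewrite mulrDl (le_trans (ler_normD _ _)) //.
  by rewrite lerD ?hB ?hC.
- exists (B * C) => x r r1 xr; rewrite normrM exprD mulrACA.
  by rewrite ler_pM ?hB ?hC.
Qed.

End PolynomialFunctions.

(** * Sign patterns *)

Module SignPatterns.

Import all_boot all_order all_algebra all_classical all_reals all_analysis.
Import zify lra PolynomialFunctions.
Set Implicit Arguments.
Unset Strict Implicit.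
Unset Printing Implicit Defensive.
Import Order.TTheory GRing.Theory Num.Theory.
Import numFieldNormedType.Exports.
Local Open Scope classical_set_scope.
Local Open Scope ring_scope.

Section Patterns.
Variables (R : realType) (n : nat).
Implicit Types (f g : 'rV[R]_n -> R) (x y z : 'rV[R]_n).

Lemma polyfun_continuous d f : polyfun d f -> continuous f.
Proof.
elim=> {d f} [d c|d j|d f g _ cf _ cg|d e f g _ cf _ cg] x.
- exact: cst_continuous.
- exact: coord_continuous.
- exact: (cvgD (cf x) (cg x)).
- exact: (cvgM (cf x) (cg x)).
Qed.

Lemma closed_nonneg (h : 'rV[R]_n -> R) : continuous h -> closed [set x | 0 <= h x].
Proof.
move=> /continuous_closedP ch.
by have := ch _ (@closed_ge R 0).
Qed.

Lemma exists_pos_lower_bound (I : finType) (h : I -> R) :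
  (forall i, 0 < h i) -> exists2 e, 0 < e & forall i, e < h i.
Proof.
move=> h0; pose e := \big[Num.min/1]_i h i.
have e0 : 0 < e by apply/lt_bigmin => //.
exists (e / 2) => [|i]; first by lra.
have : e <= h i by apply: bigmin_le_cond.
by lra.
Qed.

Lemma horner_deriv_local_max (p : {poly R}) :
  (\forall t \near (0 : R), p.[t] <= p.[0]) -> p^`().[0] = 0.
Proof.
move=> /nbhs_ballP[e /= e0 pe].
have e_itv : (0 : R) \in `](- e), e[ by rewrite in_itv /= oppr_lt0 e0.
have p_max t : t \in `](- e), e[ -> p.[t] <= p.[0].
  by rewrite in_itv /= => te; apply: pe; rewrite /ball /= sub0r normrN ltr_norml.
have le_e : - e <= e by lra.
have d0 : is_derive (0 : R) 1 (horner p) 0.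
  by apply: (derive1_at_max le_e) => // t _; exact: derivable_horner.
have dp := is_derive_poly p 0.
by rewrite -(@derive_val _ _ _ _ _ _ _ dp) (@derive_val _ _ _ _ _ _ _ d0).
Qed.

(** For [r] the largest absolute coordinate, the power sum is at least [r ^+ D.+2], whereas [F x] is
    at most [C * r ^+ D]. If [r > 1], this leaves [e * r ^+ 2 <= C], hence [r <= C / e]. *)
Lemma coercive_bound (D : nat) (F : 'rV[R]_n -> R) (e : R) : ~~ odd D ->
  polyfun D F -> 0 < e ->
  exists r, forall x, 0 <= F x - e * \sum_i x 0 i ^+ D.+2 ->
    forall i, `|x 0 i| <= r.
Proof.
move=> oddD pF e0; have [C hC] := polyfun_bound pF.
exists (Num.max 1 (C / e)) => x Gx i.
have [j _ xj] := @arg_maxP _ R 'I_n i xpredT (fun j => `|x 0 j|) isT.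
apply: le_trans (xj i isT) _; set r := `|x 0 j|.
rewrite le_max; have [//|r1 /=] := leP r 1.
have D0 t : 0 <= t ^+ D.+2 :> R.
  by apply: exprn_even_ge0; rewrite /= negbK.
have rS : r ^+ D.+2 <= \sum_i x 0 i ^+ D.+2.
  rewrite (bigD1 j) //= -normrX ger0_norm ?D0 // lerDl.
  exact: sumr_ge0.
have FC : F x <= C * r ^+ D.
  apply: le_trans (ler_norm _) _; apply: hC; first exact: ltW.
  by move=> k; apply: xj.
have r0 : 0 < r ^+ D by rewrite exprn_gt0 // (lt_trans ltr01).
have : e * (r * r * r ^+ D) <= C * r ^+ D.
  rewrite -mulrA -!exprS; apply: le_trans FC.
  have : e * r ^+ D.+2 <= e * \sum_i x 0 i ^+ D.+2 by rewrite ler_pM2l.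
  lra.
rewrite mulrA ler_pM2r // => eC.
rewrite ler_pdivlMr // mulrC; apply: le_trans eC.
by rewrite ler_pM2l // ler_peMr // ltW // (lt_trans ltr01).
Qed.

Lemma card_strict_sign_patterns (d m K : nat) (f : 'I_m -> 'rV[R]_n -> R)
    (y : 'I_K -> 'rV[R]_n) :
  (forall j, polyfun d (f j)) -> (forall k j, f j (y k) != 0) ->
  (forall k l, (forall j, (0 < f j (y k)) = (0 < f j (y l))) -> k = l) ->
  (K <= (2 * (m * d)).+1 ^ n)%N.
Proof.
move=> pf fy_neq0 y_sep; pose D := (2 * (m * d))%N.
pose F x := (\prod_j f j x) ^+ 2.
have pF : polyfun D F.
  have := polyfun_exp 2 (polyfun_prod (index_enum 'I_m) pf).
  by rewrite -sum1_size sum1_card card_ord.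
have F_gt0 x : (0 < F x) = [forall j, f j x != 0].
  rewrite lt_def sqr_ge0 andbT expf_eq0 /=.
  apply/idP/forallP => [/prodf_neq0 fx j|fx]; first exact: fx.
  by apply/prodf_neq0 => j _; apply: fx.
have evenD : ~~ odd D by rewrite /D oddM.
pose S x := \sum_i x 0 i ^+ D.+2.
have S_ge0 x : 0 <= S x.
  by apply: sumr_ge0 => i _; apply: exprn_even_ge0; rewrite /= negbK.
(* Finitely many points allow a common [e]; the [+ 1] keeps the denominator positive when
   [S (y k) = 0]. *)
have [e e0 he] : exists2 e, 0 < e & forall k, e < F (y k) / (S (y k) + 1).
  apply: exists_pos_lower_bound => k.
  by rewrite divr_gt0 ?ltr_wpDl ?S_ge0 // F_gt0; apply/forallP => j.
pose G x := F x - e * S x.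
have Gy_gt0 k : 0 < G (y k).
  have S1 : 0 < S (y k) + 1 by rewrite ltr_wpDl ?S_ge0.
  by have := he k; rewrite ltr_pdivlMr // mulrDr mulr1 /G; lra.
have pS : polyfun D.+2 S.
  apply: polyfun_sum => i.
  by have := polyfun_exp D.+2 (@polyfun_var R n 0 i); rewrite muln1.
have pG : polyfun D.+2 G.
  rewrite /G; apply: polyfunD; first by apply: polyfun_leq pF; lia.
  rewrite (_ : (fun _ => _) = fun x => (- e) * S x).
    by apply: (polyfunM (d := 0)) => //; apply: polyfun_cst.
  by apply: funext => x; rewrite mulNr.
have [r hr] := coercive_bound evenD pF e0.
have critical k : exists z,
    (forall j, (0 < f j z) = (0 < f j (y k))) /\
    (forall i (p : {poly R}), (forall t, G (z + t *: delta_mx 0 i) = p.[t]) ->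
      p^`().[0] = 0).
  pose s j : R := Num.sg (f j (y k)).
  (* The closed sign cell cut down to [0 <= G x] is compact by coercivity, so [G] attains its
     maximum on it. *)
  pose A := [set x | (forall j, 0 <= s j * f j x) /\ 0 <= G x].
  have sf j : continuous (fun x => s j * f j x).
    by apply: (@polyfun_continuous (0 + d)); apply: polyfunM => //; apply: polyfun_cst.
  have clA : closed A.
    rewrite (_ : A = (\bigcap_(j in setT) [set x | 0 <= s j * f j x])
                     `&` [set x | 0 <= G x]).
      apply: closedI.
        apply: closed_bigI => j _.
        exact: closed_nonneg (sf j).
      exact: closed_nonneg (polyfun_continuous pG).
    apply/seteqP; split=> x [h1 h2]; split=> // j; first by move=> _; exact: h1.
    exact: (h1 j I).
  have cA : compact A.
    pose B := [set x : 'rV[R]_n | forall i, `[- r, r]%classic (x ord0 i)].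
    apply: (@subclosed_compact _ A B) => //.
      by apply: (@rV_compact _ _ (fun=> `[- r, r]%classic)) => _; apply: segment_compact.
    move=> x [_ Gx] i /=; rewrite in_itv /= -ler_norml; exact: hr.
  have Ay : A (y k).
    split=> [j|]; last exact: ltW.
    by rewrite -normrEsg.
  have [z zA zmax] : exists2 z, z \in A & forall t, t \in A -> G t <= G z.
    apply: compact_EVT_max => //; first by exists (y k).
    by apply: continuous_subspaceT => x; apply: (polyfun_continuous pG).
  rewrite inE in zA; have [sz Gz] := zA.
  have Gz0 : 0 < G z by apply: lt_le_trans (Gy_gt0 k) _; apply: zmax; rewrite inE.
  (* As [0 < G z <= F z], the maximiser lies in the open cell. *)
  have fz0 j : f j z != 0.
    suff : 0 < F z by rewrite F_gt0 => /forallP.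
    by have := S_ge0 z; move: Gz0; rewrite /G; nra.
  have s0 j : s j != 0 by rewrite sgr_eq0.
  have sz0 j : 0 < s j * f j z by rewrite lt_def sz mulf_neq0.
  exists z; split=> [j|i p hp].
    have := sz0 j; rewrite /s; have := fy_neq0 k j.
    case: (sgrP (f j (y k))) => // fy _; first by rewrite mul1r => ->.
    by rewrite mulN1r oppr_gt0 => /lt_gtF ->.
  apply: horner_deriv_local_max.
  pose line (t : R) := z + t *: delta_mx 0 i.
  have line0 : line 0 = z by rewrite /line scale0r addr0.
  have cline : line @ 0 --> line 0.
    by apply: cvgD; [exact: cvg_cst|apply: cvgZr_tmp; exact: cvg_id].
  have near_pos (h : 'rV[R]_n -> R) : continuous h -> 0 < h z ->
      \forall t \near (0 : R), 0 < h (line t).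
    move=> ch hz; have := cvg_comp _ _ cline (ch (line 0)).
    by move=> /cvgr_gt; apply; rewrite line0.
  (* By continuity a short piece of the line stays in [A], so the maximum over [A] is a local
     maximum along the line. *)
  have near_s : \forall t \near (0 : R), forall j, 0 < s j * f j (line t).
    have near_sj j := near_pos _ (sf j) (sz0 j).
    refine (@filter_forall _ _ _ (nbhs (0 : R)) _ near_sj).
  have near_G := near_pos G (polyfun_continuous pG) Gz0.
  apply: filterS2 near_s near_G => t st Gt.
  rewrite -!hp -/(line t) -/(line 0) line0; apply: zmax; rewrite inE.
  by split=> [j|]; exact: ltW.
have /fin_all_exists[z hz] := critical.
have z_inj : injective z.
  move=> k l zkl; apply: y_sep => j.
  by have [<- _] := hz k; have [<- _] := hz l; rewrite zkl.
have /fin_all_exists2[F' pF' hF'] := fun i => polyfun_partial i pF.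
(* The derivative of [e * S] along axis [i] is [c * x 0 i ^+ D.+1], so critical points satisfy
   [x 0 i ^+ D.+1 = c^-1 * F' i x]. *)
pose c := e * D.+2%:R.
have c0 : c != 0 by rewrite mulf_neq0 ?gt_eqF // ltr0Sn.
apply: (@card_common_zeros _ _ D K (fun i x => c^-1 * F' i x) z) => // [i|k i].
  by apply: (polyfunM (d := 0)); [exact: polyfun_cst|exact: pF'].
have [p pE p'E] := hF' i (z k).
pose q : {poly R} := ('X + (z k 0 i)%:P) ^+ D.+2 + (S (z k) - z k 0 i ^+ D.+2)%:P.
have qE t : S (z k + t *: delta_mx 0 i) = q.[t].
  have SE x : S x = x 0 i ^+ D.+2 + \sum_(j | j != i) x 0 j ^+ D.+2.
    by rewrite /S (bigD1 i).
  rewrite /q !hornerE !SE !mxE !eqxx mulr1 [t + _]addrC.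
  rewrite /= -addrA [X in _ = _ + X]addrC addKr.
  congr (_ + _); apply: eq_bigr => j ji.
  by rewrite !mxE eqxx (negbTE ji) mulr0 addr0.
have q'E : q^`().[0] = D.+2%:R * z k 0 i ^+ D.+1.
  rewrite /q derivD derivC addr0 deriv_exp derivD derivX derivC addr0 mul1r.
  by rewrite hornerMn horner_exp hornerD hornerX hornerC add0r mulr_natl.
have [_ /(_ i (p - e%:P * q)) crit] := hz k.
have : (p - e%:P * q)^`().[0] = 0.
  by apply: crit => t; rewrite hornerD hornerN hornerM hornerC -pE -qE.
rewrite derivB derivM derivC mul0r add0r hornerD hornerN hornerM hornerC p'E q'E.
move=> /eqP; rewrite subr_eq0 mulrA => /eqP ->.
by rewrite mulrA mulVf ?mul1r.
Qed.

(** Subtracting a small [e] keeps positive values positive and makes all others negative, so zeros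
    disappear while the tests [0 < f j] are unchanged. *)
Lemma card_sign_patterns (d m K : nat) (f : 'I_m -> 'rV[R]_n -> R)
    (y : 'I_K -> 'rV[R]_n) :
  (forall j, polyfun d (f j)) ->
  (forall k l, (forall j, (0 < f j (y k)) = (0 < f j (y l))) -> k = l) ->
  (K <= (2 * (m * d)).+1 ^ n)%N.
Proof.
move=> pf y_sep.
have [e e0 he] : exists2 e, 0 < e &
    forall kj : 'I_K * 'I_m, e < (if 0 < f kj.2 (y kj.1) then f kj.2 (y kj.1) else 1).
  by apply: exists_pos_lower_bound => -[k j] /=; case: ifP.
have fe k j : (0 < f j (y k) - e) = (0 < f j (y k)) /\ f j (y k) - e != 0.
  by have /= := he (k, j); case: ifP => fkj ek; split; lra.
apply: (@card_strict_sign_patterns d m K (fun j x => f j x - e) y) => [j|k j|k l kl].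
- by apply: polyfunD => //; exact: polyfun_cst.
- by have [] := fe k j.
- apply: y_sep => j; have := kl j.
  by have [-> _] := fe k j; have [-> _] := fe l j.
Qed.

(** One representative per pattern bounds the number of patterns; the largest fibre has at least the
    average size. *)
Lemma sign_pigeonhole (I U : finType) (d : nat) (f : U -> 'rV[R]_n -> R)
    (th : I -> 'rV[R]_n) (J : {set I}) :
  (forall u, polyfun d (f u)) ->
  exists J' : {set I}, [/\ J' \subset J,
    (#|J| <= (2 * (#|U| * d)).+1 ^ n * #|J'|)%N &
    forall u a b, a \in J' -> b \in J' -> (0 < f u (th a)) = (0 < f u (th b))].
Proof.
move=> pf; pose pat a := [ffun u => 0 < f u (th a)].
have le_pat : (#|pat @: J| <= (2 * (#|U| * d)).+1 ^ n)%N.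
  have inv (k : 'I_#|pat @: J|) : exists a, pat a = enum_val k.
    by have /imsetP[a _ ->] := enum_valP k; exists a.
  have /fin_all_exists[r rE] := inv.
  apply: (@card_sign_patterns d _ _ (fun j => f (enum_val j)) (th \o r)) => // k l kl.
  apply: enum_val_inj; rewrite -!rE; apply/ffunP => u; rewrite !ffunE.
  by rewrite -[u]enum_rankK; exact: kl.
have [->|/finset.set0Pn[a0 a0J]] := eqVneq J finset.set0.
  by exists finset.set0; rewrite finset.sub0set cards0; split=> // u a b; rewrite inE.
pose fib p := [set a in J | pat a == p]%SET.
pose p0 := [arg max_(p > pat a0 in pat @: J) #|fib p|].
have p0max p : p \in pat @: J -> (#|fib p| <= #|fib p0|)%N.
  rewrite /p0; case: arg_maxnP => [|q _ h]; first exact: imset_f.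
  exact: h.
exists (fib p0); split.
- by apply/fintype.subsetP => a; rewrite inE => /andP[].
- apply: leq_trans (leq_mul le_pat (leqnn _)).
  rewrite -sum1_card (partition_big_imset pat) /= -sum_nat_const.
  apply: leq_sum => p pJ; apply: leq_trans (p0max p pJ).
  by rewrite -sum1_card leq_eqVlt; apply/orP; left; apply/eqP/eq_bigl => a; rewrite inE.
- move=> u a b; rewrite !inE => /andP[_ /eqP pa] /andP[_ /eqP pb].
  by have := congr1 (fun h : {ffun _} => h u) (etrans pa (esym pb)); rewrite !ffunE.
Qed.
End Patterns.

End SignPatterns.

(** * Counting interpolating networks *)

Module NetworkCount.

Import all_boot all_order all_algebra boolp Rstruct zify.
Import PolynomialFunctions SignPatterns.
Set Implicit Arguments.
Unset Strict Implicit.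
Unset Printing Implicit Defensive.
Import Order.TTheory GRing.Theory Num.Theory.
Local Open Scope ring_scope.

Lemma rsumE m (f : nat -> R) : rsum m f = \sum_(j < m) f j.
Proof. by elim: m => [|m IH]; rewrite ?big_ord0 // big_ord_recr /= -IH. Qed.

Section Networks.
Variables (W L : nat).
Hypothesis W_gt0 : (0 < W)%N.

(* Position [(l, i, j)] holds the entry [A_l i j] for [j < W] and the bias [b_l i]
   for [j = W]. *)
Definition param := ('I_L.+1 * 'I_W * 'I_W.+1)%type.
Notation params := 'rV[R]_#|{: param}|.

Definition coordinate (x : params) (l : 'I_L.+1) (i : 'I_W) (j : 'I_W.+1) : R :=
  x 0 (enum_rank (l, i, j)).

Definition affine (x : params) (l : 'I_L.+1) (i : 'I_W) (v : 'I_W -> R) : R :=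
  \sum_(j < W) coordinate x l i (widen_ord (leqnSn W) j) * v j + coordinate x l i ord_max.

(* Widths smaller than [W] are padded by zero weights. *)
Definition param_vector (P : nn_params) : params :=
  \row_s let: (l, i, j) := enum_val s : param in
    if (j < W)%N then if (j < widths P l)%N then weight P l i j else 0
    else bias P l i.

Lemma affineE P (l : 'I_L.+1) (i : 'I_W) (v : nat -> R) : (widths P l <= W)%N ->
  Rplus (rsum (widths P l) (fun j => Rmult (weight P l i j) (v j))) (bias P l i)
  = affine (param_vector P) l i v.
Proof.
move=> le_W; rewrite rsumE /affine /coordinate.
congr (_ + _); last by rewrite mxE enum_rankK /= ltnn.
rewrite (big_ord_widen W (fun j => Rmult (weight P l i j) (v j)) le_W) big_mkcond /=.
apply: eq_bigr => j _; rewrite mxE enum_rankK /= ltn_ord.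
by case: ifP => _; rewrite ?mul0r.
Qed.

Lemma polyfun_coordinate d l i j : polyfun d.+1 (fun x => coordinate x l i j).
Proof. exact: polyfun_var. Qed.

Lemma polyfun_affine d l i (h : 'I_W -> params -> R) :
  (forall j, polyfun d (h j)) -> polyfun d.+1 (fun x => affine x l i (h^~ x)).
Proof.
move=> ph; apply: polyfunD; last exact: polyfun_coordinate.
apply: polyfun_sum => j; apply: (polyfunM (d := 1)) => //.
exact: polyfun_coordinate.
Qed.

Lemma arch_width P (l : 'I_L.+1) : nn_arch P 1 1 W L -> (widths P l <= W)%N.
Proof.
case=> w0 [_ wl]; case: l => -[|l] /= lL; first by rewrite w0.
by apply/ssrnat.leP/wl; split; apply/ssrnat.leP.
Qed.

Section Count.
Variables (I U : finType) (P : I -> nn_params) (T : U -> R).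
Hypothesis archP : forall a, nn_arch (P a) 1 1 W L.

(** The loss of one pigeonhole step over [#|U| * W] preactivations, with the degree relaxed to
    [L.+1] so that all layers cost the same. *)
Let B := ((2 * (#|U| * W * L.+1)).+1 ^ #|{: param}|)%N.

(** Under a fixed activation pattern each ReLU is, at each input, either the identity or zero; each
    affine map raises the degree by one. *)
Lemma layer_polyfun l : (l <= L)%N -> exists J : {set I},
  (#|I| <= B ^ l * #|J|)%N /\
  exists h : U -> 'I_W -> params -> R, (forall u i, polyfun l (h u i)) /\
    forall a u (i : 'I_W), a \in J ->
      nn_layer (P a) (fun=> T u) l i = h u i (param_vector (P a)).
Proof.
elim: l => [_|l IH lL].
  exists setT; rewrite cardsT mul1n; split=> //.
  by exists (fun u _ _ => T u); split=> // u i; exact: polyfun_cst.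
have [J [IJ [h [ph hE]]]] := IH (ltnW lL).
pose o := Ordinal (leqW lL : l < L.+1)%N.
pose q (ui : U * 'I_W) x := affine x o ui.2 (h ui.1 ^~ x).
have pq ui : polyfun l.+1 (q ui) by exact: polyfun_affine.
have pq' ui : polyfun L.+1 (q ui) by apply: polyfun_leq (pq ui); exact: leqW.
have [J' [sJ'J JJ' sgn]] := sign_pigeonhole (fun a => param_vector (P a)) J pq'.
exists J'; split.
  apply: leq_trans IJ _; rewrite expnS [(B * _)%N]mulnC -mulnA leq_mul2l.
  by move: JJ'; rewrite card_prod card_ord => ->; rewrite orbT.
(* Signs are constant on [J'], so one positive member shows that the unit is active on all of
   [J']. *)
pose h' u i x := if [exists a in J', 0 < q (u, i) (param_vector (P a))] then q (u, i) x else 0.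
exists h'; split=> [u i|a u i aJ'].
  by rewrite /h'; case: [exists a in J', _]; [exact: pq|exact: polyfun_cst].
have aJ : a \in J by exact: subsetP sJ'J a aJ'.
have -> : nn_layer (P a) (fun=> T u) l.+1 i = relu (q (u, i) (param_vector (P a))).
  rewrite /= (@affineE (P a) o i _ (arch_width o (archP a))).
  by congr relu; rewrite /q /affine; congr (_ + _); apply: eq_bigr => j _; rewrite hE.
rewrite /h'; have -> : [exists a in J', 0 < q (u, i) (param_vector (P a))]
    = (0 < q (u, i) (param_vector (P a))).
  apply/existsP/idP => [[b /andP[bJ']]|qa]; first by rewrite (sgn _ _ _ bJ' aJ').
  by exists a; rewrite aJ'.
by rewrite /relu RmaxE; case: ltP.
Qed.

(** One more pigeonhole step, on the outputs minus thresholds, leaves networks agreeing in every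
    test, hence at most one. The [L] hidden layers and the output each cost at most a factor [B]. *)
Lemma card_separated_networks (t : U -> R) :
  (forall a b, (forall u, (t u < nn_output (P a) L (fun=> T u) 0%N)
                        = (t u < nn_output (P b) L (fun=> T u) 0%N)) -> a = b) ->
  (#|I| <= (2 * (#|U| * W * L.+1)).+1 ^ (L.+1 * W * W.+1 * L.+1))%N.
Proof.
move=> sep; have [J [IJ [h [ph hE]]]] := layer_polyfun (leqnn L).
pose q u x := affine x ord_max (Ordinal W_gt0) (h u ^~ x) + - t u.
have pq u : polyfun L.+1 (q u).
  by apply: polyfunD; [exact: polyfun_affine|exact: polyfun_cst].
have [J' [sJ'J JJ' sgn]] := sign_pigeonhole (fun a => param_vector (P a)) J pq.
have J'1 : (#|J'| <= 1)%N.
  apply/card_le1_eqP => a b aJ' bJ'; apply: sep => u.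
  have outE c : c \in J' ->
      (t u < nn_output (P c) L (fun=> T u) 0%N) = (0 < q u (param_vector (P c))).
    move=> cJ'; have cJ : c \in J by exact: subsetP sJ'J c cJ'.
    rewrite /q subr_gt0 /nn_output.
    rewrite (@affineE (P c) ord_max (Ordinal W_gt0)); last exact: arch_width.
    congr (_ < _); rewrite /affine; congr (_ + _).
    by apply: eq_bigr => j _; rewrite hE.
  by rewrite !outE //; exact: sgn.
have BE : (L.+1 * W * W.+1 = #|{: param}|)%N by rewrite !card_prod !card_ord.
apply: leq_trans IJ _; rewrite expnM BE -/B expnSr leq_mul2l; apply/orP; right.
apply: leq_trans JJ' _; rewrite -[X in (_ <= X)%N]muln1 leq_mul //.
have le_base : ((2 * (#|U| * L.+1)).+1 <= (2 * (#|U| * W * L.+1)).+1)%N.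
  by rewrite ltnS leq_pmul2l // leq_pmul2r // leq_pmulr.
by rewrite /B leq_exp2r // -BE !muln_gt0 W_gt0.
Qed.
End Count.
End Networks.

(** * Integer vectors told apart by threshold tests *)

Section Interpolation.
Variables (N M W L : nat).
Hypotheses (W_gt0 : (0 < W)%N) (interp : interpolates_SNM N M W L).

(** For vectors with nonnegative entries the norm is the plain sum. Interpolation is exact, so
    comparisons of entries become tests on network outputs. *)
Lemma card_interpolated (I U : finType) (y : I -> nat -> nat) (node tau : U -> nat) :
  (forall a, \sum_(n < N) y a n.+1 <= M)%N ->
  (forall u, 0 < node u <= N)%N ->
  (forall a b, (forall u, (tau u < y a (node u)) = (tau u < y b (node u)))%N -> a = b) ->
  (#|I| <= (2 * (#|U| * W * L.+1)).+1 ^ (L.+1 * W * W.+1 * L.+1))%N.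
Proof.
move=> sum_y nodeN sep.
have IZR_nat k : IZR (Z.of_nat k) = k%:R by rewrite -INR_IZR_INZ INRE.
have network a : exists P, nn_arch P 1 1 W L /\
    forall u, nn_output P L (fun=> INR (node u)) 0%N = (y a (node u))%:R.
  have [|g [[P [archP gP]] gx]] := interp (x := fun n => Z.of_nat (y a n)).
    rewrite rsumE; apply/RleP; rewrite INRE; have := sum_y a.
    rewrite -(ler_nat Rdefinitions.R) natr_sum; apply: le_trans.
    by apply: ler_sum => n _; rewrite Z.abs_eq ?IZR_nat //; apply: Nat2Z.is_nonneg.
  exists P; split=> // u; rewrite -gP gx ?IZR_nat //.
  by have /andP[/ssrnat.leP ? /ssrnat.leP ?] := nodeN u.
have /fin_all_exists[P hP] := network.
apply: (@card_separated_networks W L W_gt0 I U P (fun u => INR (node u)) _ (fun u => (tau u)%:R)).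
  by move=> a; have [] := hP a.
move=> a b ab; apply: sep => u; have := ab u.
by have [_ ->] := hP a; have [_ ->] := hP b; rewrite !ltr_nat.
Qed.

(** Testing for a positive entry at the [M * Q] block positions recovers the state of every
    block. *)
Lemma count_sparse Q : (M * Q <= N)%N ->
  (Q.+1 ^ M <= (2 * (M * Q * W * L.+1)).+1 ^ (L.+1 * W * W.+1 * L.+1))%N.
Proof.
move=> MQ; pose I := {ffun 'I_M -> 'I_Q.+1}.
(* At most one entry equal to 1 in each of [M] consecutive blocks of length [Q];
   [c a = Q] leaves block [a] empty. *)
pose y (c : I) (n : nat) := (\sum_(a < M) ((c a < Q) && ((a * Q + c a).+1 == n)))%N.
pose node (aq : 'I_M * 'I_Q) := (aq.1 * Q + aq.2).+1.
have := @card_interpolated I ('I_M * 'I_Q)%type y node (fun=> 0%N).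
rewrite card_ffun card_prod !card_ord; apply.
(* Each block adds at most one to the norm, and nothing if its position lies beyond the [N]
   nodes. *)
- move=> c; rewrite exchange_big /= -[X in (_ <= X)%N]card_ord -sum1_card.
  apply: leq_sum => a _; have [v|v] := ltnP (a * Q + c a) N; last first.
    rewrite big1 // => n _; case: eqP => [[E]|]; last by rewrite andbF.
    by have := ltn_ord n; rewrite -E ltnNge v.
  rewrite (bigD1 (Ordinal v)) //= big1 ?addn0 ?leq_b1 // => n nv.
  case: eqP => [[E]|]; last by rewrite andbF.
  by case/eqP: nv; apply/val_inj.
- move=> [a q]; rewrite /node /=; apply: leq_trans MQ.
  have := ltn_ord a; have := ltn_ord q; nia.
- have yE c (aq : 'I_M * 'I_Q) : (0 < y c (node aq))%N = (c aq.1 == aq.2 :> nat).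
    case: aq => a q /=; rewrite lt0n sum_nat_eq0 negb_forall.
    apply/existsP/eqP => [[b]|ca].
      rewrite /= eqb0 negbK => /andP[cb /eqP[E]].
      have ba : b = a :> nat.
        by have := ltn_ord q; nia.
      by move: E cb; rewrite (val_inj ba) => /addnI.
    by exists a; rewrite /= ca /node /= ltn_ord eqxx.
  move=> c c' cc'; apply/ffunP => a; apply/val_inj/eqP.
  have {}cc' (q : 'I_Q) : (c a == q :> nat) = (c' a == q :> nat).
    by have := cc' (a, q); rewrite !yE.
  have [ca|ca] := ltnP (c a) Q; first by have := cc' (Ordinal ca); rewrite eqxx eq_sym /= => <-.
  have [c'a|c'a] := ltnP (c' a) Q; first by have := cc' (Ordinal c'a); rewrite eqxx.
  (* If no test succeeds, both states are the empty block [Q]. *)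
  by rewrite eqn_leq (leq_trans (leq_ord _) c'a) (leq_trans (leq_ord _) ca).
Qed.

(** The entries range independently over [0, ..., Q], and the tests [q < c a] for [q < Q] read each
    of them in unary. *)
Lemma count_dense Q : (N * Q <= M)%N ->
  (Q.+1 ^ N <= (2 * (N * Q * W * L.+1)).+1 ^ (L.+1 * W * W.+1 * L.+1))%N.
Proof.
move=> NQ; pose I := {ffun 'I_N -> 'I_Q.+1}.
pose y (c : I) (n : nat) := (\sum_(a < N | a.+1 == n) c a)%N.
have yE c (a : 'I_N) : y c a.+1 = c a.
  by rewrite /y (big_pred1 a) // => b; rewrite eqSS.
have := @card_interpolated I ('I_N * 'I_Q)%type y (fun aq => aq.1.+1) (fun aq => aq.2).
rewrite card_ffun card_prod !card_ord; apply.
- move=> c; under eq_bigr do rewrite yE.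
  apply: leq_trans NQ; rewrite -[X in (X * _)%N]card_ord -sum_nat_const.
  by apply: leq_sum => a _; rewrite -ltnS.
- by move=> [a q] /=.
- move=> c c' cc'; apply/ffunP => a; apply/val_inj/eqP.
  have {}cc' (q : nat) (qQ : (q < Q)%N) : (q < c a)%N = (q < c' a)%N.
    by have := cc' (a, Ordinal qQ); rewrite !yE.
  case: (ltngtP (c a) (c' a)) => // h.
    by have := cc' _ (leq_trans h (leq_ord _)); rewrite ltnn h.
  by have := cc' _ (leq_trans h (leq_ord _)); rewrite ltnn h.
Qed.

End Interpolation.

Lemma expn_pow m n : (m ^ n)%N = Nat.pow m n.
Proof. by elim: n => // n IH; rewrite expnS IH. Qed.

Lemma interpolation_count N M W L Q : Peano.lt 0 W -> interpolates_SNM N M W L ->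
  Peano.le (Nat.mul (Nat.min N M) Q) (Nat.max N M) ->
  Peano.le (Nat.pow (S Q) (Nat.min N M))
    (Nat.pow (S (Nat.mul 2 (Nat.mul (Nat.mul (Nat.mul (Nat.min N M) Q) W) (S L))))
       (Nat.mul (Nat.mul (Nat.mul (S L) W) (S W)) (S L))).
Proof.
move=> /ssrnat.ltP W_gt0 interp /ssrnat.leP minQ; apply/ssrnat.leP.
rewrite -!expn_pow !multE.
have [/ssrnat.leP NM|/ltnW/ssrnat.leP MN] := leqP N M.
  by move: minQ; rewrite Nat.min_l // Nat.max_r //; exact: count_dense.
by move: minQ; rewrite Nat.min_r // Nat.max_l //; exact: count_sparse.
Qed.

End NetworkCount.

(** * The rate *)

Lemma ln2_pos : 0 < ln 2.
Proof. rewrite <- ln_1; apply ln_increasing; lra. Qed.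

Lemma ln_le_mono x y : 0 < x -> x <= y -> ln x <= ln y.
Proof.
intros Hx [Hxy | ->]; [apply Rlt_le, ln_increasing; assumption | apply Rle_refl].
Qed.

Lemma ln_ge_ln2 x : 2 <= x -> ln 2 <= ln x.
Proof. apply ln_le_mono; lra. Qed.

Lemma ln_le_self x : 0 < x -> ln x <= x.
Proof.
intros Hx; rewrite <- (exp_ln x Hx) at 2; pose proof (exp_ineq1_le (ln x)); lra.
Qed.

(* With [s = exp (a / 2)], the linear term is at most [2 p s] while the left-hand side
   is [s ^ 2 ln 2], so [s = O(X ^ 3)]. *)
Lemma log_of_polynomial_growth (p k : R) : 0 <= p ->
  exists K, 0 <= K /\ forall a X, 0 <= a -> 2 <= X ->
    exp a * ln 2 <= 8 * X ^ 2 * (p * a + k + 4 * ln X) -> p * a + k <= K * ln X.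
Proof.
intros Hp; pose proof ln2_pos as H2.
pose proof (Rle_abs k) as Hk; pose proof (Rabs_pos k) as Hk0.
(* The right-hand factor is at most [(2 * p + Rabs k + 4) * (X * s)]; dividing by [s * ln 2] then
   gives [s <= c * X ^ 3]. *)
set (c := 8 * (2 * p + Rabs k + 4) / ln 2).
assert (Hc : c * ln 2 = 8 * (2 * p + Rabs k + 4)) by (unfold c; field; lra).
assert (Hc0 : 0 < c) by (unfold c; apply Rdiv_lt_0_compat; lra).
(* Logarithms give [a / 2 <= ln c + 3 * ln X], and [ln X >= ln 2] absorbs constants into multiples
   of [ln X]. *)
set (K0 := Rabs (ln c) / ln 2 + 3).
assert (HK0 : 0 <= Rabs (ln c) / ln 2).
{ apply Rmult_le_pos; [apply Rabs_pos | apply Rlt_le, Rinv_0_lt_compat; lra]. }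
exists (p * (2 * K0) + Rabs k / ln 2); split.
{ assert (0 <= Rabs k / ln 2).
  { apply Rmult_le_pos; [lra | apply Rlt_le, Rinv_0_lt_compat; lra]. }
  assert (0 <= p * (2 * K0)) by (apply Rmult_le_pos; unfold K0; lra).
  lra. }
intros a X Ha HX Hexp.
pose proof (ln_ge_ln2 X HX) as HlX; pose proof (ln_le_self X ltac:(lra)) as HlX'.
set (s := exp (a / 2)) in *.
assert (Hs : exp a = s * s) by (unfold s; rewrite <- exp_plus; f_equal; field).
assert (Hs1 : 1 + a / 2 <= s) by apply exp_ineq1_le.
assert (Hpa : p * a <= p * (2 * s)) by (apply Rmult_le_compat_l; lra).
assert (HXX : 0 < X ^ 2) by (apply pow_lt; lra).
assert (Hsum : p * a + k + 4 * ln X <= (2 * p + Rabs k + 4) * (X * s)).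
{ assert (s <= X * s) by nra.
  assert (X <= X * s) by nra.
  assert (1 <= X * s) by nra.
  nra. }
assert (Hsq : s * s * ln 2 <= c * X ^ 3 * s * ln 2).
{ rewrite <- Hs; apply Rle_trans with (1 := Hexp).
  replace (c * X ^ 3 * s * ln 2) with (X ^ 2 * (c * ln 2) * (X * s)) by ring.
  rewrite Hc; apply Rle_trans with (8 * X ^ 2 * ((2 * p + Rabs k + 4) * (X * s))).
  - apply Rmult_le_compat_l; lra.
  - right; ring. }
assert (HsX : s <= c * X ^ 3).
{ apply Rmult_le_reg_r with (s * ln 2); [apply Rmult_lt_0_compat; lra | lra]. }
assert (Hln : a / 2 <= ln c + 3 * ln X).
{ replace (ln c + 3 * ln X) with (ln (c * X ^ 3)).
  - rewrite <- (ln_exp (a / 2)); apply ln_le_mono; [apply exp_pos | exact HsX].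
  - rewrite ln_mult, ln_pow by (try apply pow_lt; lra); simpl INR; ring. }
assert (Hdiv : forall r, 0 <= r -> r <= r / ln 2 * ln X).
{ intros r Hr; replace r with (r / ln 2 * ln 2) at 1 by (field; lra).
  apply Rmult_le_compat_l; [|lra].
  apply Rmult_le_pos; [lra | apply Rlt_le, Rinv_0_lt_compat; lra]. }
assert (Ha' : a <= 2 * K0 * ln X).
{ pose proof (Hdiv _ (Rabs_pos (ln c))); pose proof (Rle_abs (ln c)); unfold K0; lra. }
pose proof (Hdiv _ Hk0).
pose proof (Rmult_le_compat_l p _ _ Hp Ha'); lra.
Qed.

(** The exponent gets its 8 from [l + 1 <= 2 * l], used twice, and [w + 1 <= 2 * w]. The base is at
    most [5 * T * (w * l)], and [ln 5 <= 3 * ln 2 <= 3 * ln (w * l)] yields the 4. *)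
Lemma log_pattern_count (A Q W L : nat) (T : R) :
  (2 <= W)%nat -> (1 <= L)%nat -> 1 <= T -> INR A * INR Q <= T ->
  (S Q ^ A <= S (2 * (A * Q * W * S L)) ^ (S L * W * S W * S L))%nat ->
  INR A * ln (INR (S Q))
    <= 8 * (INR W * INR L) ^ 2 * (ln T + 4 * ln (INR W * INR L)).
Proof.
intros HW HL HT HAQ Hpow.
apply le_INR in HW, HL, Hpow; simpl in HW, HL.
rewrite !pow_INR in Hpow.
assert (Hln : INR A * ln (INR (S Q)) <=
    INR (S L * W * S W * S L) * ln (INR (S (2 * (A * Q * W * S L))))).
{ rewrite <- !ln_pow by (apply lt_0_INR; lia).
  apply ln_le_mono; [apply pow_lt, lt_0_INR; lia | exact Hpow]. }
apply Rle_trans with (1 := Hln).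
rewrite (S_INR (2 * _)), !mult_INR, (S_INR L), (S_INR W).
set (w := INR W) in *; set (l := INR L) in *.
change (INR 2) with 2.
pose proof (pos_INR A) as HA; pose proof (pos_INR Q) as HQ.
assert (HX : 2 <= w * l) by nra.
assert (HAQ0 : 0 <= INR A * INR Q) by (apply Rmult_le_pos; assumption).
assert (HB : 2 * (INR A * INR Q * w * (l + 1)) + 1 <= 5 * T * (w * l)).
{ assert (w * (l + 1) <= 2 * (w * l)) by nra.
  assert (0 <= w * (l + 1)) by nra.
  assert (INR A * INR Q * (w * (l + 1)) <= T * (2 * (w * l)))
    by (apply Rmult_le_compat; lra).
  assert (1 <= T * (w * l)) by nra.
  lra. }
assert (HB1 : 1 <= 2 * (INR A * INR Q * w * (l + 1)) + 1).
{ assert (0 <= INR A * INR Q * (w * (l + 1))) by (apply Rmult_le_pos; nra). lra. }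
assert (HlB : ln (2 * (INR A * INR Q * w * (l + 1)) + 1) <= ln T + 4 * ln (w * l)).
{ apply Rle_trans with (ln (5 * T * (w * l))); [apply ln_le_mono; lra|].
  rewrite !ln_mult by lra.
  pose proof (ln_ge_ln2 _ HX) as H2; rewrite ln_mult in H2 by lra.
  assert (ln 5 <= 3 * ln 2).
  { replace (3 * ln 2) with (ln (2 ^ 3)) by (rewrite ln_pow by lra; simpl INR; ring).
    apply ln_le_mono; lra. }
  lra. }
assert (HE : (l + 1) * w * (w + 1) * (l + 1) <= 8 * (w * l) ^ 2).
{ assert (l + 1 <= 2 * l) by lra. assert (w + 1 <= 2 * w) by lra.
  assert ((l + 1) * (l + 1) <= 2 * l * (2 * l)) by (apply Rmult_le_compat; lra).
  assert (w * (w + 1) <= w * (2 * w)) by (apply Rmult_le_compat_l; lra).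
  assert ((l + 1) * (l + 1) * (w * (w + 1)) <= 2 * l * (2 * l) * (w * (2 * w)))
    by (apply Rmult_le_compat; nra).
  lra. }
apply Rmult_le_compat; [| |exact HE|exact HlB].
- repeat apply Rmult_le_pos; lra.
- rewrite <- ln_1; apply ln_le_mono; lra.
Qed.

(** Both claims share this form: they differ only in which of [N], [M] is the minimum and in the
    constants of the growth condition. *)
Lemma interpolation_rate (p k : R) : 0 <= p ->
  exists Cp, 0 < Cp /\ forall N M W L : nat,
    (2 <= W)%nat -> (1 <= L)%nat -> (1 <= N)%nat -> (1 <= M)%nat ->
    interpolates_SNM N M W L ->
    ln (INR (Nat.max N M)) <= p * ln (INR (Nat.min N M)) + k ->
    INR W ^ 2 * INR L ^ 2 * ln (INR W * INR L)
      >= Cp * INR (Nat.min N M) * (1 + ln (INR (Nat.max N M) / INR (Nat.min N M))).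
Proof.
intros Hp; pose proof ln2_pos as H2.
destruct (log_of_polynomial_growth p k Hp) as (K & HK & Hgrowth).
assert (Hi : 0 < / ln 2) by (apply Rinv_0_lt_compat; lra).
(* The factor [8 * (K + 4)] comes from the count once [ln T <= K * ln X]; [/ ln 2 + 1] comes from
   [1 <= / ln 2 * ln (INR (S Q))]. *)
set (c := (/ ln 2 + 1) * (8 * (K + 4))).
assert (Hc : 0 < c) by (unfold c; apply Rmult_lt_0_compat; lra).
exists (/ c); split; [apply Rinv_0_lt_compat; exact Hc|].
intros N M W L HW HL HN HM Hint Hlog.
assert (HA : (1 <= Nat.min N M)%nat) by lia.
assert (HAT : (Nat.min N M <= Nat.max N M)%nat) by lia.
pose proof (@NetworkCount.interpolation_count N M W L (Nat.max N M / Nat.min N M)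
  ltac:(lia) Hint (Nat.Div0.mul_div_le _ _)) as Hcount.
set (A := Nat.min N M) in *; set (T := Nat.max N M) in *; clearbody A T.
set (Q := (T / A)%nat) in *.
assert (HQ1 : (1 <= Q)%nat) by (apply Nat.div_le_lower_bound; lia).
assert (HQA : (A * Q <= T)%nat) by (apply Nat.Div0.mul_div_le).
assert (HTQ : (T < A * S Q)%nat) by (apply Nat.mul_succ_div_gt; lia).
apply le_INR in HA, HAT, HQA; apply lt_INR in HTQ.
rewrite mult_INR in HQA, HTQ; simpl (INR 1) in HA.
assert (HSQ : 2 <= INR (S Q)) by (apply (le_INR 2); lia).
pose proof (log_pattern_count A Q W L (INR T) HW HL ltac:(lra) HQA Hcount) as Hmain.
apply le_INR in HW, HL; simpl in HW, HL.
replace (INR W ^ 2 * INR L ^ 2) with ((INR W * INR L) ^ 2) by ring.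
set (X := INR W * INR L) in *.
assert (HX : 2 <= X) by (unfold X; nra).
pose proof (ln_ge_ln2 _ HX) as HlX; pose proof (ln_ge_ln2 _ HSQ) as HlQ.
assert (HX2 : 0 < X ^ 2) by (apply pow_lt; lra).
(* A first use of the count, with only [ln (INR (S Q)) >= ln 2], bounds [ln T] by [K * ln X]; the
   second use below keeps the full logarithm. *)
assert (HT : p * ln (INR A) + k <= K * ln X).
{ apply Hgrowth; [rewrite <- ln_1; apply ln_le_mono; lra | exact HX |].
  rewrite exp_ln by lra.
  apply Rle_trans with (INR A * ln (INR (S Q))); [apply Rmult_le_compat_l; lra|].
  apply Rle_trans with (1 := Hmain).
  apply Rmult_le_compat_l; lra. }
assert (Hratio : ln (INR T / INR A) <= ln (INR (S Q))).
{ apply ln_le_mono; [apply Rdiv_lt_0_compat; lra|].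
  apply Rmult_le_reg_l with (INR A); [lra|].
  replace (INR A * (INR T / INR A)) with (INR T) by (field; lra). lra. }
assert (Hone : 1 <= / ln 2 * ln (INR (S Q))).
{ rewrite <- (Rinv_l (ln 2)) by lra; apply Rmult_le_compat_l; lra. }
apply Rle_ge, Rmult_le_reg_l with c; [exact Hc|].
replace (c * (/ c * INR A * (1 + ln (INR T / INR A))))
  with (INR A * (1 + ln (INR T / INR A))) by (field; lra).
apply Rle_trans with (INR A * ((/ ln 2 + 1) * ln (INR (S Q)))).
{ apply Rmult_le_compat_l; lra. }
replace (c * (X ^ 2 * ln X))
  with ((/ ln 2 + 1) * (8 * X ^ 2 * ((K + 4) * ln X))) by (unfold c; ring).
replace (INR A * ((/ ln 2 + 1) * ln (INR (S Q))))
  with ((/ ln 2 + 1) * (INR A * ln (INR (S Q)))) by ring.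
apply Rmult_le_compat_l; [lra|].
apply Rle_trans with (1 := Hmain).
apply Rmult_le_compat_l; lra.
Qed.

Lemma complexity_nonneg (W L : nat) : (2 <= W)%nat -> (1 <= L)%nat ->
  INR W ^ 2 * INR L ^ 2 * ln (INR W * INR L) >= 0.
Proof.
intros HW HL; apply le_INR in HW, HL; simpl in HW, HL.
assert (HX : 2 <= INR W * INR L) by nra.
pose proof (ln_ge_ln2 _ HX); pose proof ln2_pos.
apply Rle_ge; repeat apply Rmult_le_pos; try apply pow_le; lra.
Qed.

Theorem mainTheorem8 :
  (forall p C0 : R, 1 <= p -> 0 < C0 ->
     exists Cp : R, 0 < Cp /\
       forall N M W L : nat,
         (2 <= W)%nat -> (1 <= L)%nat ->
         interpolates_SNM N M W L ->
         INR N >= INR M -> INR M >= C0 * Rpower (INR N) (1 / p) ->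
         INR W ^ 2 * INR L ^ 2 * ln (INR W * INR L)
           >= Cp * INR M * (1 + ln (INR N / INR M)))
  /\
  (forall p C0 : R, 1 <= p -> 0 < C0 ->
     exists Cp : R, 0 < Cp /\
       forall N M W L : nat,
         (2 <= W)%nat -> (1 <= L)%nat ->
         interpolates_SNM N M W L ->
         INR N <= INR M -> INR M <= C0 * Rpower (INR N) p ->
         INR W ^ 2 * INR L ^ 2 * ln (INR W * INR L)
           >= Cp * INR N * (1 + ln (INR M / INR N))).
Proof.
split; intros p C0 Hp HC0.
(* The logarithm of the lower bound on [M], multiplied by [p], reads
   [ln N <= p * ln M - p * ln C0]. *)
- destruct (interpolation_rate p (- (p * ln C0))) as (Cp & HCp & Hrate); [lra|].
  exists Cp; split; [exact HCp|]; intros N M W L HW HL Hint HNM HM.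
  apply Rge_le, INR_le in HNM.
  (* For [M = 0] the right-hand side is 0, whatever the quotient by zero is. *)
  destruct (Nat.eq_dec M 0) as [->|HM0].
  { rewrite Rmult_0_r, Rmult_0_l; apply complexity_nonneg; assumption. }
  specialize (Hrate N M W L HW HL ltac:(lia) ltac:(lia) Hint).
  rewrite Nat.min_r, Nat.max_l in Hrate by lia; apply Hrate.
  apply Rge_le, ln_le_mono in HM.
  2: { apply Rmult_lt_0_compat; [lra | apply exp_pos]. }
  unfold Rpower in HM; rewrite ln_mult, ln_exp in HM by (try apply exp_pos; lra).
  apply (Rmult_le_compat_l p) in HM; [|lra].
  replace (p * (ln C0 + 1 / p * ln (INR N)))
    with (p * ln C0 + ln (INR N)) in HM by (field; lra).
  lra.
- destruct (interpolation_rate p (ln C0)) as (Cp & HCp & Hrate); [lra|].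
  exists Cp; split; [exact HCp|]; intros N M W L HW HL Hint HNM HM.
  apply INR_le in HNM.
  destruct (Nat.eq_dec N 0) as [->|HN0].
  { rewrite Rmult_0_r, Rmult_0_l; apply complexity_nonneg; assumption. }
  specialize (Hrate N M W L HW HL ltac:(lia) ltac:(lia) Hint).
  rewrite Nat.min_l, Nat.max_r in Hrate by lia; apply Hrate.
  apply ln_le_mono in HM; [|apply lt_0_INR; lia].
  unfold Rpower in HM; rewrite ln_mult, ln_exp in HM by (try apply exp_pos; lra).
  lra.
Qed.
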